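(* Let $X$ be a non-degenerate positive random variable satisfying $\mathbb{E}[X^m]<\infty$ and $\mathbb{E}[|\log X|X^m]<\infty$ for each $m\in\mathbb{N}$, and let $(X_n)_{n\in\mathbb{N}}$ be a sequence of i.i.d. copies of $X$. Let $(\widehat\lambda_n,\widehat k_n)$ be either the maximum likelihood estimators or the moment estimators computed from $X_1,\ldots,X_n$, and assume that there are $\lambda_0,k_0>0$ such that $(\widehat\lambda_n,\widehat k_n)\to(\lambda_0,k_0)$ almost surely as $n\to\infty$. Let $T_n$ be the test statistic computed from $X_1,\ldots,X_n$. Then $$\liminf_{n \rightarrow \infty} \frac{T_n}{n} \geq \Lambda_{\lambda_0,k_0} \qquad \mathbb{P}\text{-almost surely},$$ where $$\Lambda_{\lambda_0,k_0}= \int_{0}^{\infty} \left( \mathbb{E}\left[\frac{1}{X} \left( k_0 \left(\frac{X}{\lambda_0} \right)^{k_0} -k_0+1 \right)\left(1-e^{-tX}\right)\right] - \mathbb{E} \left[te^{-tX}\right] \right)^2w(t)\,dt.$$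
   Context: $w:[0,\infty)\to(0,\infty)$ is a measurable positive weight function with $\int_0^\infty (t^4+1)w(t)\,dt<\infty$. The test statistic is $$T_{n}=n \int_{0}^{\infty}\left|\frac{1}{n} \sum_{j=1}^{n} \frac{1}{X_{j}}\left(\widehat{k}_{n}\left(\frac{X_{j}}{\widehat{\lambda}_{n}}\right)^{\widehat{k}_{n}}-\widehat{k}_{n}+1\right)\left(1-e^{-tX_{j}}\right)-\frac{t}{n} \sum_{j=1}^{n} e^{-tX_{j}}\right|^{2}w(t)\,dt.$$ Maximum likelihood estimators (for the Weibull family with density $\frac{k}{\lambda^{k}}x^{k-1}\exp(-(x/\lambda)^{k})$): the solutions of $$\widehat{\lambda}_{n}=\left(\frac{1}{n}\sum_{i=1}^{n}X_{i}^{\widehat{k}_{n}}\right)^{1/\widehat{k}_{n}},\qquad \frac{n}{\widehat{k}_{n}}+\sum_{i=1}^{n}\log X_{i}=\frac{n}{\sum_{i=1}^{n}X_{i}^{\widehat{k}_{n}}} \sum_{i=1}^{n}X_{i}^{\widehat{k}_{n}} \log X_{i}.$$ Moment estimators: $\widehat{k}_{n}=\frac{\pi}{\sqrt{6}}(S_n^2)^{-1/2}$ and $\log \widehat{\lambda}_{n}=\overline{\log X}+\gamma/\widehat{k}_{n}$, where $\overline{\log X}=n^{-1}\sum_{i=1}^n \log X_{i}$, $S_{n}^2=(n-1)^{-1}\sum_{i=1}^{n}(\log X_{i} - \overline{\log X})^2$, and $\gamma$ is the Euler--Mascheroni constant. *)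

(* Defs.v *)
From HB Require Import structures.
From mathcomp Require Import all_boot all_order all_algebra.
From mathcomp Require Import all_classical all_reals all_analysis.
Set Implicit Arguments.
Unset Strict Implicit.
Unset Printing Implicit Defensive.
Import Order.TTheory GRing.Theory Num.Theory.
Import numFieldNormedType.Exports.
Local Open Scope classical_set_scope.
Local Open Scope ring_scope.

Section probability_notions.
Context d (T : measurableType d) (R : realType) (P : probability T R).

Definition mutually_independent (Xs : nat -> {RV P >-> R}) : Prop :=
  forall (J : seq nat) (A : nat -> set R),
    uniq J -> (forall j, measurable (A j)) ->
    P (\bigcap_(j in [set` J]) (Xs j @^-1` A j)) =
      (\prod_(j <- J) P (Xs j @^-1` A j))%E.

Definition iid_copies (X : {RV P >-> R}) (Xs : nat -> {RV P >-> R}) : Prop :=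
  mutually_independent Xs /\
  forall n (A : set R), measurable A ->
    distribution P (Xs n) A = distribution P X A.

Definition nondegenerate_rv (X : {RV P >-> R}) : Prop :=
  ~ exists c : R, {ae P, forall om, X om = c}.

End probability_notions.

(* Samples of size n are the first n terms x 0, ..., x n.-1 of a sequence. *)
Section weibull.
Context (R : realType).
Implicit Types (x : nat -> R) (n : nat) (lam k t : R) (w : R -> R).

Definition euler_mascheroni : R :=
  limn (fun n => \sum_(1 <= i < n.+1) i%:R^-1 - ln (n%:R : R)).

Definition weibull_mle n x lam k : Prop :=
  [/\ 0 < lam, 0 < k,
      lam = (n%:R^-1 * \sum_(i < n) x i `^ k) `^ k^-1 &
      n%:R / k + \sum_(i < n) ln (x i) =
        n%:R / (\sum_(i < n) x i `^ k) * \sum_(i < n) (x i `^ k * ln (x i))].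

Definition log_mean n x : R := n%:R^-1 * \sum_(i < n) ln (x i).

Definition log_variance n x : R :=
  (n%:R - 1)^-1 * \sum_(i < n) (ln (x i) - log_mean n x) ^+ 2.

Definition weibull_moment n x lam k : Prop :=
  [/\ 0 < lam,
      k = pi / Num.sqrt 6 * log_variance n x `^ (- 2^-1) &
      ln lam = log_mean n x + euler_mascheroni / k].

(* The likelihood equations have no solution on constant samples (hence none
   for n < 2), and the moment estimators are undefined when the sample variance
   of the logarithms vanishes.  Nothing is required of the estimators there. *)
Definition mle_estimates n x lam k : Prop :=
  (exists lam' k', weibull_mle n x lam' k') -> weibull_mle n x lam k.

Definition moment_estimates n x lam k : Prop :=
  0 < log_variance n x -> weibull_moment n x lam k.

Definition stein_term lam k t (y : R) : R :=
  y^-1 * (k * (y / lam) `^ k - k + 1) * (1 - expR (- (t * y))).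

Definition test_statistic w n x lam k : \bar R :=
  (n%:R%:E * \int[lebesgue_measure]_(t in `[0%R, +oo[)
    (`| n%:R^-1 * (\sum_(j < n) stein_term lam k t (x j))
        - t / n%:R * \sum_(j < n) expR (- (t * x j)) | ^+ 2 * w t)%:E)%E.

Definition Lambda d (T : measurableType d) (P : probability T R)
    (X : {RV P >-> R}) w lam k : \bar R :=
  (\int[lebesgue_measure]_(t in `[0%R, +oo[)
    (('E_P[fun om => stein_term lam k t (X om)]
      - 'E_P[fun om => (t * expR (- (t * X om)))%R]) ^+ 2 * (w t)%:E))%E.

End weibull.

(* Main.v *)
Require Import Defs.
From HB Require Import structures.
From mathcomp Require Import all_boot all_order all_algebra.
From mathcomp Require Import all_classical all_reals all_analysis.
From mathcomp Require Import measurable_realfun zify ring lra.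
Import Order.TTheory GRing.Theory Num.Theory.
Import numFieldNormedType.Exports.
Local Open Scope classical_set_scope.
Local Open Scope ring_scope.

(** Write [A_n t] for the difference inside the square, so that
    [T_n / n = \int |A_n t|^2 w t dt] ([test_statistic_div]), and [A t] for its
    population counterpart at [(lam0, k0)].  If, for almost every outcome,
    [A_n t --> A t] for all [t >= 0] simultaneously, then Fatou's lemma gives
    [\int (A t)^2 w t dt <= liminf T_n / n], which is the claim.

    Put [h t y := (1 - exp (- t y)) / y].  For a positive sample,
    [A_n t] is a continuous function of the two estimators and of the empirical
    means of [h t y * y^k_n], [h t y] and [exp (- t y)], where [k_n] is the
    estimated shape ([sum_stein_term]).  Two facts give the convergence.

    - The random exponent can be replaced by [k0]: for [k] close to [k0],
      [|y^k - y^k0| <= |k - k0| * C * (1 + y^M)] with [M >= 3 k0]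
      ([powR_lip_exponent]), and the empirical mean of [1 + y^M] converges,
      hence stays bounded ([envelope_law]).  What remains is the deterministic
      statement [statistic_cvg].

    - For fixed exponent [k0], a strong law of large numbers holds for all
      [t >= 0] outside one null set ([parametric_strong_law]): apply the strong
      law at each rational [t], and extend it to real [t] since the three
      families are Lipschitz in [t] with constant [1 + y^M].

    All moments of [X] being finite, a strong law under second moments is
    enough ([L2_strong_law], [iid_strong_law]).  For nonnegative pairwise
    uncorrelated variables, the empirical mean along the squares [n = (m+1)^2]
    has variance [O(1/m^2)], so the sum over [m] of its squared deviations has
    finite integral and is almost surely finite; the gaps between squares are
    filled by monotonicity of the partial sums ([cvg_mean_squares]). *)

Set Implicit Arguments.
Unset Strict Implicit.
Unset Printing Implicit Defensive.

(** * Strong law of large numbers under second moments *)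

Lemma between_squares (n : nat) : (0 < n)%N ->
  exists m, (m.+1 ^ 2 <= n < m.+2 ^ 2)%N.
Proof.
elim: n => // -[_ _|n /(_ isT) [m mn] _]; first by exists 0%N.
have [le|lt] := leqP (m.+2 ^ 2)%N n.+2.
  by exists m.+1; lia.
by exists m; lia.
Qed.

(** A sequence of nonnegative reals whose means converge along the squares has
    convergent means: for [(m+1)^2 <= n < (m+2)^2] the [n]-th mean lies between
    the means at the two squares, up to the factor [((m+2)/(m+1))^2]. *)
Lemma cvg_mean_squares (R : realType) (y : nat -> R) (mu : R) :
  (forall j, 0 <= y j) ->
  (fun m : nat => (m.+1 ^ 2)%:R^-1 * \sum_(j < m.+1 ^ 2) y j) @ \oo --> mu ->
  (fun n : nat => n%:R^-1 * \sum_(j < n) y j) @ \oo --> mu.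
Proof.
move=> y0 ymu; set c := (X in X @ _ --> _) in ymu.
have mono : forall a b : nat, (a <= b)%N -> \sum_(j < a) y j <= \sum_(j < b) y j.
  move=> a b ab; rewrite (big_ord_widen _ _ ab) big_mkcond ler_sum// => i _.
  by case: ifP.
have h1 : (fun m : nat => 1 + m.+1%:R^-1 : R) @ \oo --> (1 + 0 : R).
  by apply: cvgD; [exact: cvg_cst|exact: cvg_harmonic].
have h2 : (fun m : nat => (1 + m.+1%:R^-1)^-1 : R) @ \oo --> ((1 + 0)^-1 : R).
  by apply: cvgV => //; rewrite addr0 oner_neq0.
have cu : (fun m : nat => c m.+1 * (1 + m.+1%:R^-1) ^+ 2) @ \oo --> mu.
  have -> : mu = mu * (1 + 0) ^+ 2 by rewrite addr0 expr1n mulr1.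
  by apply: cvgM; [rewrite (cvg_shiftS c)|rewrite expr2; exact: cvgM].
have cl : (fun m : nat => c m * (1 + m.+1%:R^-1)^-1 ^+ 2) @ \oo --> mu.
  have -> : mu = mu * (1 + 0)^-1 ^+ 2 by rewrite addr0 invr1 expr1n mulr1.
  by apply: cvgM => //; rewrite expr2; exact: cvgM.
apply/cvgrPdist_lt => e e0.
move/cvgrPdist_lt : cu => /(_ _ e0) [M1 _ HM1].
move/cvgrPdist_lt : cl => /(_ _ e0) [M2 _ HM2].
exists ((maxn M1 M2).+2 ^ 2)%N => // n /= Mn.
have [|m /andP[mn nm]] := @between_squares n; first by rewrite (leq_trans _ Mn).
have mM : (maxn M1 M2 <= m)%N by nia.
have /(HM1 _) : (M1 <= m)%N by lia.
have /(HM2 _) : (M2 <= m)%N by lia.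
have m0 : (0 : R) < m.+1%:R by rewrite ltr0n.
have m1 : (0 : R) < m.+2%:R by rewrite ltr0n.
have n0 : (0 : R) < n%:R by rewrite ltr0n; nia.
have E : 1 + m.+1%:R^-1 = m.+2%:R / m.+1%:R :> R.
  by rewrite -(natr1 m.+1); field; rewrite gt_eqF.
have L : c m * (1 + m.+1%:R^-1)^-1 ^+ 2 <= n%:R^-1 * \sum_(j < n) y j.
  rewrite E /c natrX invf_div exprMn mulrAC exprVn.
  rewrite mulrA mulVf ?mul1r; last by rewrite expf_neq0// gt_eqF.
  apply: ler_pM; rewrite ?invr_ge0 ?exprn_ge0 ?ler0n ?sumr_ge0//; last exact: mono.
  by rewrite lef_pV2 ?posrE ?exprn_gt0// -natrX ler_nat ltnW.
have U : n%:R^-1 * \sum_(j < n) y j <= c m.+1 * (1 + m.+1%:R^-1) ^+ 2.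
  rewrite E /c natrX exprMn exprVn mulrAC mulrA mulVf ?mul1r; last first.
    by rewrite expf_neq0// gt_eqF.
  apply: ler_pM; rewrite ?invr_ge0 ?ler0n ?sumr_ge0//; last by rewrite mono// ltnW.
  by rewrite lef_pV2 ?posrE ?exprn_gt0// -natrX ler_nat.
rewrite /= !ltr_distlC => /andP[lo _] /andP[_ up].
by rewrite (lt_le_trans lo)//= (le_lt_trans U).
Qed.

Section L2_strong_law.
Context d (T : measurableType d) (R : realType) (P : probability T R).
Variables (Y : nat -> T -> R) (mu v : R).
Hypothesis mY : forall i, measurable_fun [set: T] (Y i).
Hypothesis Y0 : forall i x, 0 <= Y i x.
Hypothesis EY : forall i, (\int[P]_x (Y i x)%:E = mu%:E)%E.
Hypothesis EYY : forall i j,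
  (\int[P]_x (Y i x * Y j x)%:E = (if i == j then v else mu ^+ 2)%:E)%E.

Let mu0 : 0 <= mu.
Proof. by rewrite -lee_fin -(EY 0) integral_ge0// => x _; rewrite lee_fin. Qed.

Let S n x : R := \sum_(j < n) Y j x.

Let S0 n x : 0 <= S n x. Proof. exact: sumr_ge0. Qed.

Let mS n : measurable_fun [set: T] (S n).
Proof. exact: measurable_sum. Qed.

Let ES n : (\int[P]_x (S n x)%:E = (n%:R * mu)%:E)%E.
Proof.
under eq_integral do rewrite /S -sumEFin.
rewrite ge0_integral_sum//; last 2 first.
- by move=> i; exact/measurable_EFinP.
- by move=> i x _; rewrite lee_fin.
under eq_bigr do rewrite EY.
by rewrite sumEFin sumr_const card_ord mulr_natl.
Qed.

Let ES2 n : (\int[P]_x (S n x ^+ 2)%:E =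
  (n%:R * (v - mu ^+ 2) + (n%:R * mu) ^+ 2)%:E)%E.
Proof.
under eq_integral do rewrite /S expr2 big_distrlr/= -sumEFin.
rewrite ge0_integral_sum//; last 2 first.
- move=> i; apply/measurable_EFinP; apply: measurable_sum => j.
  exact: measurable_funM.
- by move=> i x _; rewrite lee_fin sumr_ge0// => j _; rewrite mulr_ge0.
under eq_bigr => i _.
  under eq_integral do rewrite -sumEFin.
  rewrite ge0_integral_sum//; last 2 first.
  - by move=> j; apply/measurable_EFinP; exact: measurable_funM.
  - by move=> j x _; rewrite lee_fin mulr_ge0.
  under eq_bigr do rewrite EYY.
  rewrite sumEFin.
  over.
rewrite sumEFin; congr EFin.
rewrite (eq_bigr (fun=> (v - mu ^+ 2) + n%:R * mu ^+ 2)).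
  rewrite sumr_const card_ord -mulr_natl; ring.
move=> i _; rewrite (bigD1 i)//= eqxx (eq_bigr (fun=> mu ^+ 2)); last first.
  by move=> j ji; rewrite eq_sym -val_eqE in ji *; rewrite (negbTE ji).
rewrite sumr_const cardC1 card_ord -mulr_natl.
by case: n i => [[]//|n i] /=; rewrite -natr1; ring.
Qed.

Let variance_mean n : (0 < n)%N ->
  (\int[P]_x ((n%:R^-1 * S n x - mu) ^+ 2)%:E = ((v - mu ^+ 2) / n%:R)%:E)%E.
Proof.
move=> n0; have nR : n%:R != 0 :> R by rewrite pnatr_eq0 -lt0n.
have mE : measurable_fun [set: T] (fun x => (n%:R^-1 * S n x - mu) ^+ 2).
  apply: measurable_funX; apply: measurable_funB => //.
  exact: measurable_funM.
have k0 : 0 <= 2 * mu / n%:R by rewrite mulr_ge0// ?mulr_ge0// invr_ge0.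
(* The square is expanded with the cross term on the left, so that every
   integrand is nonnegative. *)
have : (\int[P]_x ((n%:R^-1 * S n x - mu) ^+ 2)%:E +
    \int[P]_x ((2 * mu / n%:R) * S n x)%:E =
    \int[P]_x (n%:R^-2 * S n x ^+ 2)%:E + \int[P]_x (mu ^+ 2)%:E)%E.
  rewrite -!ge0_integralD//.
  - by apply: eq_integral => x _; rewrite -!EFinD; congr EFin; field.
  - by move=> x _; rewrite lee_fin mulr_ge0// ?invr_ge0 ?exprn_ge0.
  - apply/measurable_EFinP; apply: measurable_funM => //.
    exact: measurable_funX.
  - by move=> x _; rewrite lee_fin sqr_ge0.
  - by move=> x _; rewrite lee_fin sqr_ge0.
  - exact/measurable_EFinP.
  - by move=> x _; rewrite lee_fin mulr_ge0.
  - by apply/measurable_EFinP; apply: measurable_funM.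
under [X in (_ + X = _)%E -> _]eq_integral do rewrite EFinM.
rewrite ge0_integralZl_EFin//; last 2 first.
- by move=> x _; rewrite lee_fin.
- exact/measurable_EFinP.
under [X in (_ = X + _)%E -> _]eq_integral do rewrite EFinM.
rewrite ge0_integralZl_EFin//; last 2 first.
- by move=> x _; rewrite lee_fin sqr_ge0.
- by apply/measurable_EFinP; exact: measurable_funX.
rewrite ES ES2 integral_cst//= probability_setT mule1 -!EFinM -!EFinD.
set I := (X in (X + _ = _)%E -> _) => H.
have : (I = I + (2 * mu / n%:R * (n%:R * mu))%:E
              - (2 * mu / n%:R * (n%:R * mu))%:E)%E.
  by rewrite addeK.
by rewrite H -EFinB => E; apply: (etrans E); congr EFin; field.
Qed.

(** Strong law for nonnegative random variables with common mean [mu] and common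
    second moment [v] that are pairwise uncorrelated. *)
Lemma L2_strong_law :
  {ae P, forall x, (fun n => n%:R^-1 * \sum_(j < n) Y j x) @ \oo --> mu}.
Proof.
pose D m x := ((m.+1 ^ 2)%:R^-1 * S (m.+1 ^ 2) x - mu) ^+ 2.
have mD m : measurable_fun [set: T] (D m).
  apply: measurable_funX; apply: measurable_funB => //.
  exact: measurable_funM.
have D0 m x : 0 <= D m x by rewrite sqr_ge0.
have v0 : 0 <= v - mu ^+ 2.
  have := @variance_mean 1%N isT; rewrite divr1 => E.
  by rewrite -lee_fin -E integral_ge0// => x _; rewrite lee_fin sqr_ge0.
have mDE m : measurable_fun [set: T] (fun x => (D m x)%:E).
  exact/measurable_EFinP.
have finD : (\int[P]_x (\sum_(m <oo) (D m x)%:E) < +oo)%E.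
  rewrite integral_nneseries//; last by move=> m x _; rewrite lee_fin.
  apply: (@le_lt_trans _ _ (2 * (v - mu ^+ 2))%:E); last by rewrite ltry.
  apply: lime_le.
    apply: is_cvg_nneseries => m _ _.
    by apply: integral_ge0 => x _; rewrite lee_fin.
  apply: nearW => K.
  under eq_bigr do rewrite variance_mean ?expn_gt0//.
  rewrite sumEFin lee_fin -mulr_sumr mulrC ler_wpM2r//.
  (* 1/(i+1)^2 <= 2/((i+1)(i+2)), which telescopes. *)
  suff : \sum_(0 <= i < K) ((i.+1 ^ 2)%:R^-1 : R) <= 2 * (1 - K.+1%:R^-1).
    by move=> /le_trans; apply; rewrite ler_piMr// lerBlDr lerDl invr_ge0.
  elim: K => [|K IH]; first by rewrite big_geq// invr1 subrr mulr0.
  rewrite big_nat_recr//= (le_trans (lerD IH (lexx _)))//.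
  have a0 : (0 : R) < K.+1%:R by rewrite ltr0n.
  rewrite natrX -(natr1 K.+1).
  move: (K.+1%:R : R) a0 (ler1n R K.+1) => a a0; rewrite /= => a1.
  rewrite -subr_ge0.
  rewrite (_ : _ - _ = (a - 1) / (a ^+ 2 * (a + 1))); last first.
    by field; rewrite !gt_eqF// addr_gt0.
  by rewrite divr_ge0 ?subr_ge0// mulr_ge0 ?exprn_ge0 ?addr_ge0// ltW.
have mser : measurable_fun [set: T] (fun x => \sum_(m <oo) (D m x)%:E)%E.
  by apply: ge0_emeasurable_sum => // m x _; rewrite lee_fin.
have /integrable_ae : P.-integrable [set: T] (fun x => \sum_(m <oo) (D m x)%:E)%E.
  apply/integrableP; split=> //.
  rewrite (eq_integral (fun x => \sum_(m <oo) (D m x)%:E)%E)// => x _.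
  by rewrite gee0_abs// nneseries_ge0// => m _ _; rewrite lee_fin.
move=> /(_ measurableT) fin; apply: filterS fin => x /(_ I) fx.
apply: (@cvg_mean_squares _ (Y ^~ x)) => //.
have D_cvg : D ^~ x @ \oo --> 0.
  apply: cvg_series_cvg_0; apply: nnseries_is_cvg => //.
  by rewrite ltey_eq fx.
have : (fun m => Num.sqrt (D m x)) @ \oo --> Num.sqrt (0 : R).
  by apply: continuous_cvg => //; exact: sqrt_continuous.
rewrite sqrtr0 /=; under eq_fun do rewrite /D sqrtr_sqr.
by move=> /norm_cvg0P /subr_cvg0.
Qed.

End L2_strong_law.

(** By uniqueness of the product measure, the law of [(U, V)] is the product of
    the laws of [U] and [V], and Tonelli's theorem applies. *)
Lemma integral_mul_independent d (T : measurableType d) (R : realType)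
    (P : probability T R) (U V : {RV P >-> R}) (f g : R -> R) :
  (forall A B, measurable A -> measurable B ->
     P (U @^-1` A `&` V @^-1` B) = (P (U @^-1` A) * P (V @^-1` B))%E) ->
  measurable_fun [set: R] f -> measurable_fun [set: R] g ->
  (forall y, 0 <= f y) -> (forall y, 0 <= g y) ->
  (\int[P]_x (f (U x) * g (V x))%:E =
   \int[P]_x (f (U x))%:E * \int[P]_x (g (V x))%:E)%E.
Proof.
move=> UV mf mg f0 g0.
pose phi x := (U x, V x).
have mphi : measurable_fun [set: T] phi by exact: measurable_fun_pair.
pose Phi : {mfun T >-> (R * R)%type} :=
  HB.pack phi (isMeasurableFun.Build _ _ _ _ _ mphi).
pose h (z : R * R) := (f z.1 * g z.2)%:E.
have mh : measurable_fun [set: R * R] h.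
  apply/measurable_EFinP; apply: measurable_funM.
    exact: measurableT_comp.
  exact: measurableT_comp.
have h0 z : (0 <= h z)%E by rewrite lee_fin mulr_ge0.
transitivity (\int[distribution P Phi]_z h z)%E.
  by rewrite ge0_integral_distribution.
rewrite (@eq_measure_integral _ _ _ _ (distribution P U \x distribution P V)%E);
    last first.
  by move=> A mA _; exact/esym/product_measure_unique.
rewrite fubini_tonelli1// /fubini_F /h /=.
under eq_integral => x _.
  under eq_integral do rewrite EFinM.
  rewrite ge0_integralZl_EFin//; last 2 first.
  - by move=> y _; rewrite lee_fin.
  - exact/measurable_EFinP.
  rewrite (@ge0_integral_distribution _ _ _ _ _ P V (EFin \o g))//; last first.
    exact/measurable_EFinP.
  over.
rewrite /= ge0_integralZr//; last 3 first.
- exact/measurable_EFinP.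
- by move=> y _; rewrite lee_fin.
- by apply: integral_ge0 => y _; rewrite lee_fin.
rewrite (@ge0_integral_distribution _ _ _ _ _ P U (EFin \o f))//.
exact/measurable_EFinP.
Qed.

Section iid.
Context d (T : measurableType d) (R : realType) (P : probability T R).
Variables (X : {RV P >-> R}) (Xs : nat -> {RV P >-> R}).

Lemma ge0_integral_same_distribution (U V : {RV P >-> R}) (g : R -> R) :
  (forall A, measurable A -> distribution P U A = distribution P V A) ->
  measurable_fun [set: R] g -> (forall y, 0 <= g y) ->
  (\int[P]_x (g (U x))%:E = \int[P]_x (g (V x))%:E)%E.
Proof.
move=> UV mg g0.
have mE : measurable_fun [set: R] (EFin \o g) by exact/measurable_EFinP.
rewrite -(@ge0_integral_distribution _ _ _ _ _ P U (EFin \o g))//.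
rewrite -(@ge0_integral_distribution _ _ _ _ _ P V (EFin \o g))//.
by apply: eq_measure_integral => A mA _; exact: UV.
Qed.

Lemma ge0_square_integrable_expectation (V : T -> R) :
  measurable_fun [set: T] V -> (forall x, 0 <= V x) ->
  (\int[P]_x (V x ^+ 2)%:E < +oo)%E -> ('E_P[V])%E \is a fin_num.
Proof.
move=> mV V0 V2; rewrite unlock ge0_fin_numE; last first.
  by apply: integral_ge0 => x _; rewrite lee_fin.
apply: (@le_lt_trans _ _ (\int[P]_x (1 + (V x ^+ 2)%:E))%E).
  apply: ge0_le_integral => //.
  - by move=> x _; rewrite lee_fin.
  - exact/measurable_EFinP.
  - apply/measurable_EFinP; apply: measurable_funD => //.
    exact: measurable_funX.
  - move=> x _; rewrite -EFinD lee_fin; have := sqr_ge0 (V x - 1).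
    have := sqr_ge0 (V x); nra.
rewrite ge0_integralD//.
- by rewrite integral_cst//= probability_setT mule1 lte_add_pinfty// ltry.
- by move=> x _; rewrite lee_fin sqr_ge0.
- by apply/measurable_EFinP; exact: measurable_funX.
Qed.

Hypothesis Xs_iid : iid_copies X Xs.

Lemma iid_strong_law (g : R -> R) :
  measurable_fun [set: R] g -> (forall y, 0 <= g y) ->
  (\int[P]_x (g (X x) ^+ 2)%:E < +oo)%E ->
  {ae P, forall x, (fun n => n%:R^-1 * \sum_(j < n) g (Xs j x)) @ \oo -->
    fine ('E_P[fun x => g (X x)])%E}.
Proof.
move=> mg g0 g2; have [Xs_indep Xs_law] := Xs_iid.
have mgX (V : {RV P >-> R}) : measurable_fun [set: T] (fun x => g (V x)).
  exact: measurableT_comp.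
have Efin := ge0_square_integrable_expectation (mgX X) (fun x => g0 _) g2.
have E i : (\int[P]_x (g (Xs i x))%:E =
    (fine ('E_P[fun x => g (X x)])%E)%:E)%E.
  rewrite (@ge0_integral_same_distribution _ X)//; last exact: Xs_law.
  by rewrite fineK// unlock.
apply: (@L2_strong_law _ _ _ P (fun i x => g (Xs i x)) _
   (fine (\int[P]_x (g (X x) ^+ 2)%:E))) => // i j.
have [->|ij] := eqVneq i j.
  rewrite -(@ge0_integral_same_distribution (Xs j) X (fun y => g y ^+ 2)).
  - rewrite fineK.
    + by apply: eq_integral => x _; rewrite expr2.
    + rewrite (@ge0_integral_same_distribution (Xs j) X (fun y => g y ^+ 2)).
      * rewrite ge0_fin_numE// integral_ge0// => x _; by rewrite lee_fin sqr_ge0.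
      * exact: Xs_law.
      * exact: measurable_funX.
      * by move=> y; rewrite sqr_ge0.
  - exact: Xs_law.
  - exact: measurable_funX.
  - by move=> y; rewrite sqr_ge0.
rewrite (@integral_mul_independent _ _ _ P (Xs i) (Xs j) g g)//.
  by rewrite !E expr2.
move=> A B mA mB.
have := @Xs_indep [:: i; j] (fun k => if k == i then A else B).
rewrite /= inE ij => /(_ isT).
rewrite !big_cons big_nil mule1 eqxx eq_sym (negbTE ij).
move=> <-; last by move=> k; case: ifP.
congr (P _); apply/seteqP; split=> x /=.
  move=> [xA xB] k /=; rewrite !inE => /orP[/eqP->|/eqP->].
    by rewrite eqxx.
  by rewrite eq_sym (negbTE ij).
move=> H; split.
  by have := H i; rewrite /= eqxx; apply; rewrite inE eqxx.
have := H j; rewrite /= eq_sym (negbTE ij); apply.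
by rewrite !inE eqxx orbT.
Qed.

Lemma same_distribution_gt0 (U V : {RV P >-> R}) :
  (forall A, measurable A -> distribution P U A = distribution P V A) ->
  {ae P, forall x, 0 < V x} -> {ae P, forall x, 0 < U x}.
Proof.
move=> UV.
have pos (W : {RV P >-> R}) :
    ~` [set x | 0 < W x] = W @^-1` [set y | y <= 0].
  apply/seteqP; split=> x /=; first by move/negP; rewrite -leNgt.
  by rewrite leNgt => /negP.
have mneg : measurable [set y : R | y <= 0].
  have -> : [set y : R | y <= 0] = [set` `]-oo, (0 : R)]].
    by apply/seteqP; split => y /=; rewrite in_itv.
  exact: measurable_itv.
have mpos (W : {RV P >-> R}) : measurable (W @^-1` [set y | y <= 0]).
  by rewrite -[X in measurable X]setTI; exact: measurable_funPT.
rewrite /almost_everywhere /= /prop_near1 /nbhs /=.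
move=> HV; apply/negligibleP; first by rewrite pos; exact: mpos.
rewrite pos.
move/negligibleP: HV => /=; rewrite pos => /(_ (mpos V)) <-.
exact: UV.
Qed.

End iid.

(** * Strong law uniform over a Lipschitz family *)

Section parametric_strong_law.
Context d (T : measurableType d) (R : realType) (P : probability T R).
Variables (X : {RV P >-> R}) (Xs : nat -> {RV P >-> R}).
Hypothesis Xs_iid : iid_copies X Xs.
Hypothesis X_gt0 : {ae P, forall x, 0 < X x}.
Variables (F : R -> R -> R) (B : R -> R).
Hypothesis mF : forall t, 0 <= t -> measurable_fun [set: R] (F t).
Hypothesis F0 : forall t y, 0 <= t -> 0 <= F t y.
Hypothesis mB : measurable_fun [set: R] B.
Hypothesis B0 : forall y, 0 <= B y.
Hypothesis B2 : (\int[P]_x (B (X x) ^+ 2)%:E < +oo)%E.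
Hypothesis F_bound : forall t y, 0 <= t -> 0 < y -> F t y <= (1 + t) * B y.
Hypothesis F_lip : forall s t y, 0 <= s -> 0 <= t -> 0 < y ->
  `|F t y - F s y| <= `|t - s| * B y.

Let mFX t : 0 <= t -> measurable_fun [set: T] (fun x => F t (X x)).
Proof. by move=> t0; apply: measurableT_comp => //; exact: mF. Qed.

Let mBX : measurable_fun [set: T] (fun x => B (X x)).
Proof. exact: measurableT_comp. Qed.

Let F2 t : 0 <= t -> (\int[P]_x (F t (X x) ^+ 2)%:E < +oo)%E.
Proof.
move=> t0.
apply: (@le_lt_trans _ _ (\int[P]_x (((1 + t) ^+ 2)%:E * (B (X x) ^+ 2)%:E))%E).
  apply: ae_ge0_le_integral => //.
  - by move=> x _; rewrite lee_fin sqr_ge0.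
  - by apply/measurable_EFinP; apply: measurable_funX; exact: mFX.
  - by move=> x _; rewrite lee_fin mulr_ge0 ?sqr_ge0.
  - apply/measurable_EFinP; apply: measurable_funM => //.
    exact: measurable_funX.
  - apply: filterS X_gt0 => x x0 _; rewrite lee_fin -exprMn.
    by rewrite lerXn2r ?nnegrE ?F_bound ?F0// mulr_ge0 ?addr_ge0.
rewrite ge0_integralZl_EFin ?sqr_ge0//.
- by rewrite lte_mul_pinfty// lee_fin sqr_ge0.
- by move=> x _; rewrite lee_fin sqr_ge0.
- by apply/measurable_EFinP; exact: measurable_funX.
Qed.

Let m t := fine ('E_P[fun x => F t (X x)])%E.
Let mb := fine ('E_P[fun x => B (X x)])%E.

Lemma parametric_expectation_fin_num t : 0 <= t ->
  ('E_P[fun x => F t (X x)])%E \is a fin_num.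
Proof.
move=> t0; apply: ge0_square_integrable_expectation; [exact: mFX| |exact: F2].
by move=> x; exact: F0.
Qed.

Let Em t : 0 <= t -> (\int[P]_x (F t (X x))%:E = (m t)%:E)%E.
Proof.
move=> t0; rewrite /m fineK; first by rewrite unlock.
exact: parametric_expectation_fin_num.
Qed.

Let Emb : (\int[P]_x (B (X x))%:E = mb%:E)%E.
Proof.
rewrite /mb fineK; first by rewrite unlock.
by apply: ge0_square_integrable_expectation.
Qed.

Let mb0 : 0 <= mb.
Proof. by rewrite -lee_fin -Emb integral_ge0// => x _; rewrite lee_fin. Qed.

Let m_lip1 s t : 0 <= s -> 0 <= t -> m t <= m s + `|t - s| * mb.
Proof.
move=> s0 t0; rewrite -lee_fin EFinD EFinM -!Em// -Emb.
rewrite -ge0_integralZl_EFin//; last 2 first.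
- by move=> x _; rewrite lee_fin.
- exact/measurable_EFinP.
rewrite -ge0_integralD//; last 4 first.
- by move=> x _; rewrite lee_fin F0.
- by apply/measurable_EFinP; exact: mFX.
- by move=> x _; rewrite lee_fin mulr_ge0.
- by apply/measurable_EFinP; apply: measurable_funM.
apply: ae_ge0_le_integral => //.
- by move=> x _; rewrite lee_fin F0.
- by apply/measurable_EFinP; exact: mFX.
- by move=> x _; rewrite lee_fin addr_ge0 ?mulr_ge0 ?F0.
- apply/measurable_EFinP; apply: measurable_funD; first exact: mFX.
  exact: measurable_funM.
- apply: filterS X_gt0 => x x0 _; rewrite lee_fin -lerBlDl.
  by rewrite (le_trans (ler_norm _))// F_lip.
Qed.

Let m_lip s t : 0 <= s -> 0 <= t -> `|m t - m s| <= `|t - s| * mb.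
Proof.
move=> s0 t0; rewrite ler_norml lerBlDl m_lip1// andbT.
by rewrite lerBrDl lerBlDr distrC m_lip1.
Qed.

(* An enumeration of the nonnegative rationals, as real numbers. *)
Let ratpos (n : nat) : R := `|ratr (odflt 0 (unpickle n : option rat))|.

(** The exceptional null set does not depend on [t]: it is the one of the
    rational parameters and of the envelope [B], which controls the error made
    by replacing [t] with a nearby rational. *)
Lemma parametric_strong_law :
  {ae P, forall x, forall t, 0 <= t ->
    (fun n => n%:R^-1 * \sum_(j < n) F t (Xs j x)) @ \oo -->
    fine ('E_P[fun x => F t (X x)])%E}.
Proof.
have Xs_gt0 : {ae P, forall x, forall j, 0 < Xs j x}.
  apply: ae_foralln => j; apply: same_distribution_gt0 X_gt0.
  by have [_] := Xs_iid; exact.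
have Frat : {ae P, forall x, forall i,
    (fun n => n%:R^-1 * \sum_(j < n) F (ratpos i) (Xs j x)) @ \oo -->
    m (ratpos i)}.
  apply: ae_foralln => i.
  have i0 : 0 <= ratpos i by exact: normr_ge0.
  apply: (iid_strong_law Xs_iid (mF i0) _ (F2 i0)) => y.
  exact: F0.
have Bcvg := iid_strong_law Xs_iid mB B0 B2.
near=> x => t t0.
have Xx j : 0 < Xs j x.
  by move: j; near: x.
have Fx i : (fun n => n%:R^-1 * \sum_(j < n) F (ratpos i) (Xs j x)) @ \oo
    --> m (ratpos i).
  by move: i; near: x.
have Bx : (fun n => n%:R^-1 * \sum_(j < n) B (Xs j x)) @ \oo --> mb.
  by near: x.
have avg_lip s n : 0 <= s ->
    `|n%:R^-1 * \sum_(j < n) F t (Xs j x) -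
      n%:R^-1 * \sum_(j < n) F s (Xs j x)|
    <= `|t - s| * (n%:R^-1 * \sum_(j < n) B (Xs j x)).
  move=> s0; rewrite -mulrBr -sumrB normrM ger0_norm ?invr_ge0//.
  rewrite mulrCA ler_wpM2l ?invr_ge0// mulr_sumr (le_trans (ler_norm_sum _ _ _))//.
  by rewrite ler_sum// => j _; exact: F_lip.
apply/cvgrPdist_lt => e e0.
pose del := e / 4 / (mb + 1).
have mb1 : 0 < mb + 1 by rewrite ltr_wpDl.
have del0 : 0 < del by rewrite !divr_gt0.
have : t < t + del by rewrite ltrDl.
move=> /rat_in_itvoo[q /itvP qt].
have [i qi] : exists i, ratpos i = ratr q.
  exists (pickle q); rewrite /ratpos pickleK/= ger0_norm//.
  by rewrite (le_trans t0)// qt.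
have s0 : 0 <= ratpos i by exact: normr_ge0.
have ts : `|t - ratpos i| <= del.
  by rewrite qi distrC ger0_norm ?subr_ge0 ?qt// lerBlDl qt.
have /cvgrPdist_lt/(_ (e / 4)) H1 := Fx i.
have /cvgrPdist_lt/(_ 1 ltr01) H2 := Bx.
have e4 : 0 < e / 4 by rewrite divr_gt0.
near=> n.
have A1 : `|m (ratpos i) - n%:R^-1 * \sum_(j < n) F (ratpos i) (Xs j x)| < e / 4.
  by near: n; exact: H1.
have A2 : n%:R^-1 * \sum_(j < n) B (Xs j x) <= mb + 1.
  suff : `|mb - n%:R^-1 * \sum_(j < n) B (Xs j x)| < 1.
    by rewrite ltr_distlC => /andP[_ /ltW].
  by near: n; exact: H2.
have A3 := avg_lip (ratpos i) n s0.
have A4 := m_lip s0 t0.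
have D0 : del * (mb + 1) = e / 4 by rewrite /del divfK ?gt_eqF.
have D1 : `|t - ratpos i| * (n%:R^-1 * \sum_(j < n) B (Xs j x)) <= e / 4.
  rewrite -D0 (le_trans (ler_wpM2l _ A2))//.
  by apply: ler_wpM2r => //; exact: ltW.
have D2 : `|t - ratpos i| * mb <= e / 4.
  by rewrite -D0 ler_pM// lerDl.
rewrite (_ : _ - _ = (m t - m (ratpos i)) +
  (m (ratpos i) - n%:R^-1 * \sum_(j < n) F (ratpos i) (Xs j x)) +
  (n%:R^-1 * \sum_(j < n) F (ratpos i) (Xs j x) -
   n%:R^-1 * \sum_(j < n) F t (Xs j x)));
  last by rewrite /m; ring.
apply: (@lt_le_trans _ _ (e / 4 + e / 4 + e / 4)); last by lra.
rewrite (le_lt_trans (ler_normD _ _))// ltr_leD//; last first.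
  by rewrite distrC (le_trans A3).
by rewrite (le_lt_trans (ler_normD _ _))// ler_ltD// (le_trans A4).
Unshelve. all: by end_near.
Qed.
End parametric_strong_law.

(** * Elementary bounds on the kernels *)

Section kernels.
Variable R : realType.
Implicit Types s t y k a b : R.

(** The kernel [(1 - exp (- t y)) / y], that is the integral of [exp (- s y)]
    over [s] between [0] and [t]; its value at [y = 0] is [0], which is
    immaterial as the samples are positive. *)
Definition laplace_kernel t y : R := y^-1 * (1 - expR (- (t * y))).

Lemma expRN_lip a b : 0 <= a -> 0 <= b -> `|expR (- a) - expR (- b)| <= `|a - b|.
Proof.
wlog ab : a b / a <= b => [H a0 b0|a0 b0].
  have [ab|/ltW ba] := leP a b; first exact: H.
  by rewrite distrC (distrC a) H.
rewrite ger0_norm ?subr_ge0 ?ler_expR ?lerN2//.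
rewrite ler0_norm ?subr_le0// opprB.
have -> : expR (- b) = expR (- a) * expR (a - b).
  by rewrite -expRD; congr expR; ring.
rewrite -[X in X - _]mulr1 -mulrBr.
have h1 : expR (- a) <= 1 by rewrite expR_le1 oppr_le0.
have h2 := expR_ge1Dx (a - b).
have h3 : 0 <= 1 - expR (a - b) by rewrite subr_ge0 expR_le1 subr_le0.
rewrite (le_trans (ler_wpM2r h3 h1))// mul1r; lra.
Qed.

Lemma laplace_kernel_ge0 t y : 0 <= t -> 0 <= laplace_kernel t y.
Proof.
move=> t0; rewrite /laplace_kernel; have [y0|y0] := leP 0 y.
  by rewrite mulr_ge0 ?invr_ge0// subr_ge0 expR_le1 oppr_le0 mulr_ge0.
have h : 1 <= expR (- (t * y)).
  by rewrite -[leLHS]expR0 ler_expR oppr_ge0 mulr_ge0_le0// ltW.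
by apply: mulr_le0; rewrite ?invr_le0 ?subr_le0// ltW.
Qed.

Lemma laplace_kernel_lip s t y : 0 <= s -> 0 <= t -> 0 < y ->
  `|laplace_kernel t y - laplace_kernel s y| <= `|t - s|.
Proof.
move=> s0 t0 y0; rewrite /laplace_kernel -mulrBr.
have -> : 1 - expR (- (t * y)) - (1 - expR (- (s * y))) =
  expR (- (s * y)) - expR (- (t * y)) by ring.
rewrite normrM gtr0_norm ?invr_gt0// ler_pdivrMl//.
rewrite (le_trans (expRN_lip _ _)) ?mulr_ge0// ?(ltW y0)//.
by rewrite -mulrBl normrM (gtr0_norm y0) mulrC distrC.
Qed.

Lemma laplace_kernel_le t y : 0 <= t -> 0 < y -> laplace_kernel t y <= t.
Proof.
move=> t0 y0; have := laplace_kernel_lip (lexx 0) t0 y0.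
have -> : laplace_kernel 0 y = 0.
  by rewrite /laplace_kernel mul0r oppr0 expR0 subrr mulr0.
by rewrite !subr0 (ger0_norm t0) ger0_norm ?laplace_kernel_ge0.
Qed.

Lemma measurable_invr : measurable_fun [set: R] (fun y => y^-1).
Proof.
have -> : (fun y => y^-1) = (fun y => y * `|y| `^ (- 2%:R)).
  apply/funext => y; rewrite powR_invn// real_normK ?num_real//.
  by have [->|y0] := eqVneq y 0; [rewrite invr0 mul0r|field].
apply: measurable_funM => //.
apply: (measurableT_comp (measurable_powR _)).
exact: normr_measurable.
Qed.

Lemma measurable_laplace_kernel t : measurable_fun [set: R] (laplace_kernel t).
Proof.
apply: measurable_funM.
  exact: measurable_invr.
apply: measurable_funB => //; apply: measurableT_comp => //.
apply: measurable_funN; exact: measurable_funM.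
Qed.

Lemma powR_expR k y : 0 < y -> y `^ k = expR (k * ln y).
Proof. by move=> y0; rewrite /powR gt_eqF. Qed.

Lemma powR_le1DX (M : nat) k y : 0 < y -> 0 <= k -> k <= M%:R ->
  y `^ k <= 1 + `|y| ^+ M.
Proof.
move=> y0 k0 kM; rewrite gtr0_norm//; have [y1|y1] := leP y 1.
  rewrite (@le_trans _ _ 1)//; last by rewrite lerDl exprn_ge0// ltW.
  by rewrite -(powRr0 y) ger_powR// y0.
rewrite (@le_trans _ _ (y ^+ M))//; last by rewrite lerDr.
by rewrite -powR_mulrn ?(ltW y0)// ler_powR// ltW.
Qed.

Lemma expR_lip a b : `|expR a - expR b| <= `|a - b| * (expR a + expR b).
Proof.
wlog ab : a b / a <= b => [H|].
  have [ab|/ltW ba] := leP a b; first exact: H.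
  by rewrite distrC (distrC a) [expR a + _]addrC H.
rewrite ler0_norm ?subr_le0 ?ler_expR// ler0_norm ?subr_le0// !opprB.
have h2 := expR_ge1Dx (a - b).
have -> : expR a = expR b * expR (a - b) by rewrite -expRD; congr expR; ring.
have Eb := expR_ge0 b; have Eab := expR_ge0 (a - b).
have h5 : 1 - expR (a - b) <= b - a by lra.
rewrite -{1}(mulr1 (expR b)) -mulrBr (le_trans (ler_wpM2l Eb h5))// mulrC.
by rewrite ler_wpM2l ?subr_ge0// lerDr mulr_ge0.
Qed.

(** The logarithm produced by differentiating [y^k] in [k] is absorbed by
    [|ln y| <= (y^e + y^(-e)) / e] with [e = k0 / 2]; all exponents that occur
    then lie between [0] and [3 k0], so that their powers are at most
    [1 + y^M]. *)
Lemma powR_lip_exponent (M : nat) k k0 y : 0 < y -> 0 < k0 -> 3 * k0 <= M%:R ->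
  `|k - k0| <= k0 / 2 ->
  `|y `^ k - y `^ k0| <= `|k - k0| * (8 / k0 * (1 + `|y| ^+ M)).
Proof.
move=> y0 k00 kM; rewrite ler_distl => /andP[kl ku].
rewrite !powR_expR// (le_trans (expR_lip _ _))//.
rewrite -mulrBl normrM -[leLHS]mulrA ler_wpM2l//.
set u := ln y; set e := k0 / 2.
have e0 : 0 < e by rewrite divr_gt0.
have ule : `|u| <= e^-1 * (expR (e * u) + expR (- (e * u))).
  rewrite ler_pdivlMl// -[X in X * `|u|](gtr0_norm e0) -normrM.
  have := expR_ge1Dx (e * u); have := expR_ge1Dx (- (e * u)).
  have := expR_gt0 (e * u); have := expR_gt0 (- (e * u)).
  rewrite ler_norml => *; apply/andP; split; lra.
rewrite (le_trans (ler_wpM2r _ ule)) ?addr_ge0 ?expR_ge0//.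
have bd k' : 0 <= k' -> k' <= M%:R -> expR (k' * u) <= 1 + `|y| ^+ M.
  by move=> *; rewrite -powR_expR// powR_le1DX.
have -> : 8 / k0 * (1 + `|y| ^+ M) = e^-1 * (4 * (1 + `|y| ^+ M)).
  by rewrite /e; field; rewrite gt_eqF.
rewrite -mulrA ler_wpM2l ?invr_ge0 ?(ltW e0)//.
rewrite mulrDl !mulrDr -!expRD.
have b1 := bd (k + e); have b2 := bd (k - e).
have b3 := bd (k0 + e); have b4 := bd (k0 - e).
have -> : e * u + k * u = (k + e) * u by ring.
have -> : e * u + k0 * u = (k0 + e) * u by ring.
have -> : - (e * u) + k * u = (k - e) * u by ring.
have -> : - (e * u) + k0 * u = (k0 - e) * u by ring.
rewrite /e in b1 b2 b3 b4 *.
have := b1 ltac:(lra) ltac:(lra); have := b2 ltac:(lra) ltac:(lra).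
have := b3 ltac:(lra) ltac:(lra); have := b4 ltac:(lra) ltac:(lra).
move=> *; lra.
Qed.

End kernels.

(** * Convergence of the statistic along a fixed sample *)

Section statistic_convergence.
Variable R : realType.

Lemma sum_stein_term n (x : nat -> R) lam k t : 0 < lam -> (forall j, 0 < x j) ->
  n%:R^-1 * \sum_(j < n) stein_term lam k t (x j) =
  k * lam^-1 `^ k * (n%:R^-1 * \sum_(j < n) (laplace_kernel t (x j) * x j `^ k))
  - (k - 1) * (n%:R^-1 * \sum_(j < n) laplace_kernel t (x j)).
Proof.
move=> lam0 x0.
rewrite mulrCA [X in _ - X]mulrCA -mulrBr; congr (_ * _).
rewrite !mulr_sumr -sumrB.
apply: eq_bigr => j _; rewrite /stein_term /laplace_kernel.
rewrite powRM ?invr_ge0 ?(ltW (x0 j)) ?(ltW lam0)//; ring.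
Qed.

(** No randomness is involved: [x] is a positive sample along which the relevant
    empirical means converge. *)
Lemma statistic_cvg (x lam k : nat -> R) (lam0 k0 t m1 m2 m3 b : R) (M : nat) :
  (forall j, 0 < x j) -> 0 < lam0 -> 0 < k0 -> 0 <= t -> 3 * k0 <= M%:R ->
  lam @ \oo --> lam0 -> k @ \oo --> k0 ->
  (fun n => n%:R^-1 * \sum_(j < n) laplace_kernel t (x j)) @ \oo --> m1 ->
  (fun n => n%:R^-1 * \sum_(j < n) (laplace_kernel t (x j) * x j `^ k0)) @ \oo
    --> m2 ->
  (fun n => n%:R^-1 * \sum_(j < n) expR (- (t * x j))) @ \oo --> m3 ->
  (fun n => n%:R^-1 * \sum_(j < n) (1 + `|x j| ^+ M)) @ \oo --> b ->
  (fun n => n%:R^-1 * (\sum_(j < n) stein_term (lam n) (k n) t (x j))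
        - t / n%:R * \sum_(j < n) expR (- (t * x j))) @ \oo -->
  k0 * lam0^-1 `^ k0 * m2 - (k0 - 1) * m1 - t * m3.
Proof.
move=> x0 lam00 k00 t0 kM clam ck c1 c2 c3 cb.
(* Replacing the exponent [k n] by [k0] costs at most a multiple of
   [|k n - k0|] times the mean of the envelope. *)
have cpow : (fun n =>
    n%:R^-1 * \sum_(j < n) (laplace_kernel t (x j) * x j `^ (k n))) @ \oo --> m2.
  apply: (cvg_sub0 _ c2); apply: norm_cvg0.
  have c0 : (fun n => `|k n - k0| * (t * (8 / k0) *
      (n%:R^-1 * \sum_(j < n) (1 + `|x j| ^+ M)))) @ \oo --> (0 : R).
    have E : `|k0 - k0| * (t * (8 / k0) * b) = 0 by rewrite subrr normr0 mul0r.
    rewrite -[X in _ --> X]E.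
    apply: cvgM; last exact: (cvgM (cvg_cst _) cb).
    exact: (cvg_norm (cvgB ck (cvg_cst _))).
  apply: (squeeze_cvgr _ (cvg_cst 0) c0).
  have /cvgrPdist_le/(_ (k0 / 2) (divr_gt0 k00 (ltr0Sn _ 1))) := ck.
  apply: filterS => n; rewrite distrC => kn; rewrite normr_ge0 !fctE/=.
  rewrite -mulrBr -sumrB normrM ger0_norm ?invr_ge0//.
  rewrite [leRHS](_ : _ = n%:R^-1 * \sum_(j < n)
     (t * (`|k n - k0| * (8 / k0 * (1 + `|x j| ^+ M))))); last first.
    by rewrite -!mulr_sumr; ring.
  rewrite ler_wpM2l ?invr_ge0// (le_trans (ler_norm_sum _ _ _))//.
  rewrite ler_sum// => j _; rewrite -mulrBr normrM.
  rewrite ger0_norm ?laplace_kernel_ge0// ler_pM ?laplace_kernel_ge0//.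
    exact: laplace_kernel_le.
  exact: powR_lip_exponent.
have clamk : (fun n => (lam n)^-1 `^ (k n)) @ \oo --> lam0^-1 `^ k0.
  rewrite powR_expR ?invr_gt0//.
  have : (fun n => expR (k n * ln (lam n)^-1)) @ \oo --> expR (k0 * ln lam0^-1).
    apply: continuous_cvg; first exact: continuous_expR.
    apply: cvgM => //; apply: continuous_cvg.
      by apply: continuous_ln; rewrite invr_gt0.
    by apply: cvgV => //; rewrite gt_eqF.
  apply: cvg_trans; apply: near_eq_cvg.
  have /cvgr_gt/(_ _ lam00) := clam.
  by apply: filterS => n lamn; rewrite powR_expR// invr_gt0.
have : (fun n =>
   k n * (lam n)^-1 `^ k n *
     (n%:R^-1 * \sum_(j < n) (laplace_kernel t (x j) * x j `^ k n))
   - (k n - 1) * (n%:R^-1 * \sum_(j < n) laplace_kernel t (x j))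
   - t * (n%:R^-1 * \sum_(j < n) expR (- (t * x j)))) @ \oo -->
   k0 * lam0^-1 `^ k0 * m2 - (k0 - 1) * m1 - t * m3.
  apply: cvgB; last exact: (cvgM (cvg_cst _) c3).
  apply: cvgB; first exact: (cvgM (cvgM ck clamk) cpow).
  exact: (cvgM (cvgB ck (cvg_cst _)) c1).
apply: cvg_trans; apply: near_eq_cvg.
have /cvgr_gt/(_ _ lam00) := clam.
by apply: filterS => n lamn; rewrite sum_stein_term// !mulrA.
Qed.

End statistic_convergence.

(** * Integrability and the population limit *)

Section expectations.
Context d (T : measurableType d) (R : realType) (P : probability T R).
Variable X : {RV P >-> R}.

Lemma square_integrable_envelope (M : nat) :
  ('E_P[fun x => (X x ^+ (2 * M))%R] < +oo)%E ->
  (\int[P]_x ((1 + `|X x| ^+ M) ^+ 2)%:E < +oo)%E.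
Proof.
rewrite unlock => XM.
have mXM : measurable_fun [set: T] (fun x => X x ^+ (2 * M)).
  exact: measurable_funX.
have XM0 x : 0 <= X x ^+ (2 * M) by rewrite exprM exprn_ge0// sqr_ge0.
apply: (@le_lt_trans _ _ (\int[P]_x (2%:E + 2%:E * (X x ^+ (2 * M))%:E))%E).
  apply: ge0_le_integral => //.
  - apply/measurable_EFinP; apply: measurable_funX; apply: measurable_funD => //.
    by apply: measurable_funX; exact: measurableT_comp.
  - apply/measurable_EFinP; apply: measurable_funD => //.
    exact: measurable_funM.
  - move=> x _; rewrite -EFinM -EFinD lee_fin.
    have -> : X x ^+ (2 * M) = (`|X x| ^+ M) ^+ 2.
      by rewrite -normrX real_normK ?num_real// mulnC exprM.
    have := sqr_ge0 (1 - `|X x| ^+ M); nra.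
rewrite ge0_integralD//; last 2 first.
- by move=> x _; rewrite mule_ge0// lee_fin.
- by apply/measurable_EFinP; exact: measurable_funM.
rewrite integral_cst//= probability_setT mule1.
rewrite ge0_integralZl_EFin//; last 2 first.
- by move=> x _; rewrite lee_fin.
- exact/measurable_EFinP.
by rewrite lte_add_pinfty ?ltry// lte_mul_pinfty// lee_fin.
Qed.

Lemma ge0_expectation_integrable (V : T -> R) :
  measurable_fun [set: T] V -> (forall x, 0 <= V x) ->
  'E_P[V]%E \is a fin_num -> P.-integrable [set: T] (EFin \o V).
Proof.
move=> mV V0; rewrite unlock ge0_fin_numE; last first.
  by apply: integral_ge0 => x _; rewrite lee_fin.
move=> Voo; apply/integrableP; split; first exact/measurable_EFinP.
rewrite (eq_integral (EFin \o V))// => x _.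
by rewrite gee0_abs// lee_fin.
Qed.

(** Population counterpart of [sum_stein_term]. *)
Lemma expectation_stein_term (lam k t : R) : 0 < lam -> 0 <= t ->
  {ae P, forall x, 0 < X x} ->
  'E_P[fun x => laplace_kernel t (X x)]%E \is a fin_num ->
  'E_P[fun x => (laplace_kernel t (X x) * X x `^ k)%R]%E \is a fin_num ->
  'E_P[fun x => stein_term lam k t (X x)]%E =
  (k * lam^-1 `^ k * fine ('E_P[fun x => (laplace_kernel t (X x) * X x `^ k)%R])%E
  - (k - 1) * fine ('E_P[fun x => laplace_kernel t (X x)])%E)%:E.
Proof.
move=> lam0 t0 X_gt0 fin1 fin2.
set h1 := fun x => laplace_kernel t (X x) in fin1 *.
set h2 := fun x => laplace_kernel t (X x) * X x `^ k in fin2 *.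
have mh1 : measurable_fun [set: T] h1.
  by apply: measurableT_comp => //; exact: measurable_laplace_kernel.
have mpow : measurable_fun [set: T] (fun x => X x `^ k).
  exact: (measurableT_comp (measurable_powR k)).
have mh2 : measurable_fun [set: T] h2 by exact: measurable_funM.
have int1 : P.-integrable [set: T] (EFin \o h1).
  by apply: ge0_expectation_integrable => // x; exact: laplace_kernel_ge0.
have int2 : P.-integrable [set: T] (EFin \o h2).
  apply: ge0_expectation_integrable => // x.
  by rewrite mulr_ge0 ?powR_ge0 ?laplace_kernel_ge0.
rewrite EFinB !EFinM !fineK// unlock.
rewrite -EFinM -!integralZl// -integralB//; last 2 first.
- exact: integrableZl.
- exact: integrableZl.
apply: ae_eq_integral => //.
- apply/measurable_EFinP.
  apply: measurable_funM.
    apply: measurable_funM.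
      exact: (measurableT_comp (@measurable_invr R)).
    apply: measurable_funD => //; apply: measurable_funB => //.
    apply: measurable_funM => //.
    apply: (measurableT_comp (measurable_powR k)).
    exact: measurable_funM.
  apply: measurable_funB => //; apply: measurableT_comp => //.
  by apply: measurable_funN; exact: measurable_funM.
- apply: emeasurable_funB; apply/measurable_EFinP; exact: measurable_funM.
- apply: filterS X_gt0 => x x0 _ /=; rewrite -!EFinM -EFinB; congr EFin.
  rewrite /stein_term /h1 /h2 /laplace_kernel.
  by rewrite powRM ?invr_ge0 ?(ltW x0) ?(ltW lam0)//; ring.
Qed.

End expectations.

Section test_statistic.
Variable R : realType.

(** For [n = 0] both sides vanish, the integrand being zero. *)
Lemma test_statistic_div (w : R -> R) n (x : nat -> R) lam k :
  ((n%:R^-1)%:E * test_statistic w n x lam k =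
  \int[lebesgue_measure]_(t in `[0%R, +oo[)
    (`| n%:R^-1 * (\sum_(j < n) stein_term lam k t (x j))
        - t / n%:R * \sum_(j < n) expR (- (t * x j)) | ^+ 2 * w t)%:E)%E.
Proof.
rewrite /test_statistic muleA -EFinM; have [->|n0] := posnP n.
  rewrite mulr0 mul0e (eq_integral (cst 0%E)) ?integral0// => t _.
  by rewrite !big_ord0 !mulr0 subrr normr0 expr0n mul0r.
by rewrite mulVf ?mul1e// pnatr_eq0 -lt0n.
Qed.

Lemma measurable_statistic_integrand (w : R -> R) n (x : nat -> R) lam k :
  measurable_fun (`[0, +oo[ : set R) w ->
  measurable_fun (`[0, +oo[ : set R) (fun t =>
    (`| n%:R^-1 * (\sum_(j < n) stein_term lam k t (x j))
        - t / n%:R * \sum_(j < n) expR (- (t * x j)) | ^+ 2 * w t)%:E).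
Proof.
move=> mw; apply/measurable_EFinP; apply: measurable_funM => //.
have mexp j : measurable_fun (`[0, +oo[ : set R) (fun t => expR (- (t * x j))).
  apply: measurableT_comp => //.
  by apply: measurable_funN; exact: measurable_funM.
apply: measurable_funX; apply: measurableT_comp => //.
apply: measurable_funB; apply: measurable_funM => //.
- apply: measurable_sum => j; apply: measurable_funM => //.
  exact: measurable_funB.
- exact: measurable_funM.
- by apply: measurable_sum => j; exact: mexp.
Qed.

End test_statistic.

(** * Strong laws for the three kernels *)

Section kernel_laws.
Context d (T : measurableType d) (R : realType) (P : probability T R).
Variables (X : {RV P >-> R}) (Xs : nat -> {RV P >-> R}) (M : nat) (k0 : R).
Hypothesis Xs_iid : iid_copies X Xs.
Hypothesis X_gt0 : {ae P, forall x, 0 < X x}.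
Hypothesis XM : ('E_P[fun x => (X x ^+ (2 * M))%R] < +oo)%E.
Hypothesis M_gt0 : (0 < M)%N.
Hypothesis k0_ge0 : 0 <= k0.
Hypothesis k0M : k0 <= M%:R.

(* The common envelope of the three families. *)
Let B (y : R) : R := 1 + `|y| ^+ M.

Let B1 y : 1 <= B y.
Proof. by rewrite lerDl exprn_ge0. Qed.

Let B0 y : 0 <= B y.
Proof. exact: le_trans (B1 y). Qed.

Let mB : measurable_fun [set: R] B.
Proof.
apply: measurable_funD => //; apply: measurable_funX.
exact: normr_measurable.
Qed.

Let B2 : (\int[P]_x (B (X x) ^+ 2)%:E < +oo)%E.
Proof. exact: square_integrable_envelope. Qed.

Let le_B y : 0 < y -> y <= B y.
Proof.
by move=> y0; rewrite -{1}(powRr1 (ltW y0)) powR_le1DX// ler1n.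
Qed.

Lemma envelope_law : {ae P, forall x, exists b : R,
  (fun n => n%:R^-1 * \sum_(j < n) (1 + `|Xs j x| ^+ M)) @ \oo --> b}.
Proof.
have := iid_strong_law Xs_iid mB B0 B2; apply: filterS => x H.
by eexists; exact: H.
Qed.

Let lap (t y : R) : R := laplace_kernel t y.

Let lap_bound t y : 0 <= t -> 0 < y -> lap t y <= (1 + t) * B y.
Proof.
move=> t0 y0; rewrite (le_trans (laplace_kernel_le t0 y0))//.
by rewrite -[leLHS]mulr1 ler_pM// lerDr.
Qed.

Let lap_lip s t y : 0 <= s -> 0 <= t -> 0 < y ->
  `|lap t y - lap s y| <= `|t - s| * B y.
Proof.
move=> s0 t0 y0; rewrite (le_trans (laplace_kernel_lip s0 t0 y0))//.
by rewrite -[leLHS]mulr1 ler_wpM2l.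
Qed.

Lemma laplace_kernel_fin_num t : 0 <= t ->
  ('E_P[fun x => laplace_kernel t (X x)])%E \is a fin_num.
Proof.
apply: (@parametric_expectation_fin_num _ _ _ P X X_gt0 lap B) => //.
- by move=> s _; exact: measurable_laplace_kernel.
- by move=> s y s0; exact: laplace_kernel_ge0.
Qed.

Lemma laplace_kernel_law : {ae P, forall x, forall t, 0 <= t ->
  (fun n => n%:R^-1 * \sum_(j < n) laplace_kernel t (Xs j x)) @ \oo -->
    fine ('E_P[fun x => laplace_kernel t (X x)])%E}.
Proof.
apply: (@parametric_strong_law _ _ _ P X Xs Xs_iid X_gt0 lap B) => //.
- by move=> s _; exact: measurable_laplace_kernel.
- by move=> s y s0; exact: laplace_kernel_ge0.
Qed.

Let lapow (t y : R) : R := laplace_kernel t y * y `^ k0.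

Let mlapow t : measurable_fun [set: R] (lapow t).
Proof.
apply: measurable_funM; first exact: measurable_laplace_kernel.
exact: measurable_powR.
Qed.

Let lapow0 t y : 0 <= t -> 0 <= lapow t y.
Proof. by move=> t0; rewrite mulr_ge0 ?laplace_kernel_ge0 ?powR_ge0. Qed.

Let lapow_bound t y : 0 <= t -> 0 < y -> lapow t y <= (1 + t) * B y.
Proof.
move=> t0 y0; apply: ler_pM; rewrite ?laplace_kernel_ge0 ?powR_ge0//.
  by rewrite (le_trans (laplace_kernel_le t0 y0))// lerDr.
exact: powR_le1DX.
Qed.

Let lapow_lip s t y : 0 <= s -> 0 <= t -> 0 < y ->
  `|lapow t y - lapow s y| <= `|t - s| * B y.
Proof.
move=> s0 t0 y0; rewrite /lapow -mulrBl normrM ler_pM//.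
  exact: laplace_kernel_lip.
by rewrite ger0_norm ?powR_ge0// powR_le1DX.
Qed.

Lemma laplace_kernel_powR_fin_num t : 0 <= t ->
  ('E_P[fun x => (laplace_kernel t (X x) * X x `^ k0)%R])%E \is a fin_num.
Proof. exact: (@parametric_expectation_fin_num _ _ _ P X X_gt0 lapow B). Qed.

Lemma laplace_kernel_powR_law : {ae P, forall x, forall t, 0 <= t ->
  (fun n => n%:R^-1 * \sum_(j < n) (laplace_kernel t (Xs j x) * Xs j x `^ k0))
    @ \oo --> fine ('E_P[fun x => (laplace_kernel t (X x) * X x `^ k0)%R])%E}.
Proof. exact: (@parametric_strong_law _ _ _ P X Xs Xs_iid X_gt0 lapow B). Qed.

Let ex (t y : R) : R := expR (- (t * y)).

Let mex t : measurable_fun [set: R] (ex t).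
Proof.
by apply: measurableT_comp => //; apply: measurable_funN; exact: measurable_funM.
Qed.

Let ex_bound t y : 0 <= t -> 0 < y -> ex t y <= (1 + t) * B y.
Proof.
move=> t0 y0; rewrite (@le_trans _ _ 1)//.
  by rewrite expR_le1 oppr_le0 mulr_ge0// ltW.
by rewrite -[leLHS]mulr1 ler_pM// lerDl.
Qed.

Let ex_lip s t y : 0 <= s -> 0 <= t -> 0 < y ->
  `|ex t y - ex s y| <= `|t - s| * B y.
Proof.
move=> s0 t0 y0; rewrite (le_trans (expRN_lip _ _)) ?mulr_ge0 ?(ltW y0)//.
by rewrite -mulrBl normrM (gtr0_norm y0) ler_wpM2l// le_B.
Qed.

Lemma laplace_fin_num t : 0 <= t ->
  ('E_P[fun x => expR (- (t * X x))])%E \is a fin_num.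
Proof.
apply: (@parametric_expectation_fin_num _ _ _ P X X_gt0 ex B) => //.
by move=> s y _; exact: expR_ge0.
Qed.

Lemma laplace_law : {ae P, forall x, forall t, 0 <= t ->
  (fun n => n%:R^-1 * \sum_(j < n) expR (- (t * Xs j x))) @ \oo -->
    fine ('E_P[fun x => expR (- (t * X x))])%E}.
Proof.
apply: (@parametric_strong_law _ _ _ P X Xs Xs_iid X_gt0 ex B) => //.
by move=> s y _; exact: expR_ge0.
Qed.

End kernel_laws.

(** * The lower bound *)

Unset Implicit Arguments.
Set Strict Implicit.
Set Printing Implicit Defensive.

Theorem theorem8 (R : realType) (d : measure_display) (T : measurableType d)
  (P : probability T R)
  (w : R -> R)
  (w_meas : measurable_fun (`[0, +oo[ : set R) w)
  (w_pos : forall t : R, 0 <= t -> 0 < w t)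
  (w_int : (\int[lebesgue_measure]_(t in `[0%R, +oo[)
              ((t ^+ 4 + 1) * w t)%:E < +oo)%E)
  (X : {RV P >-> R})
  (X_nondeg : nondegenerate_rv X)
  (X_pos : {ae P, forall om, 0 < X om})
  (X_mom : forall m : nat, (0 < m)%N ->
     ('E_P[fun om => (X om ^+ m)%R] < +oo)%E)
  (X_logmom : forall m : nat, (0 < m)%N ->
     ('E_P[fun om => (`|ln (X om)| * X om ^+ m)%R] < +oo)%E)
  (Xs : nat -> {RV P >-> R})
  (Xs_iid : iid_copies X Xs)
  (lamhat khat : nat -> {RV P >-> R})
  (estimators :
     {ae P, forall om, forall n : nat,
        mle_estimates n (fun j => Xs j om) (lamhat n om) (khat n om)} \/
     {ae P, forall om, forall n : nat,
        moment_estimates n (fun j => Xs j om) (lamhat n om) (khat n om)})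
  (lam0 k0 : R) (lam0_pos : 0 < lam0) (k0_pos : 0 < k0)
  (consistent :
     {ae P, forall om,
        ((fun n => lamhat n om) @ \oo --> lam0) /\
        ((fun n => khat n om) @ \oo --> k0)}) :
  {ae P, forall om,
     (Lambda X w lam0 k0 <=
      limn_einf (fun n : nat =>
        (n%:R^-1)%:E *
        test_statistic w n (fun j => Xs j om) (lamhat n om) (khat n om)))%E}.
Proof.
pose M := (Num.bound (3 * k0)).+1.
have kM : 3 * k0 <= M%:R.
  have k30 : 0 <= 3 * k0 by rewrite mulr_ge0// ltW.
  by rewrite (le_trans (ltW (archi_boundP k30)))// ler_nat leqnSn.
have k0M : k0 <= M%:R by lra.
have M_gt0 : (0 < M)%N by [].
have XM : ('E_P[fun x => (X x ^+ (2 * M))%R] < +oo)%E by exact: X_mom.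
have k0_ge0 := ltW k0_pos.
have Xs_gt0 : {ae P, forall om, forall j, 0 < Xs j om}.
  apply: ae_foralln => j; apply: same_distribution_gt0 X_pos.
  by have [_] := Xs_iid; exact.
have law1 := laplace_kernel_law Xs_iid X_pos XM.
have law2 := laplace_kernel_powR_law Xs_iid X_pos XM k0_ge0 k0M.
have law3 := laplace_law Xs_iid X_pos XM M_gt0.
have lawB := envelope_law Xs_iid XM.
near=> om.
have x0 : forall j, 0 < Xs j om by near: om.
have [clam ck] : ((fun n => lamhat n om) @ \oo --> lam0) /\
    ((fun n => khat n om) @ \oo --> k0) by near: om.
have cB : exists b : R,
  (fun n => n%:R^-1 * \sum_(j < n) (1 + `|Xs j om| ^+ M)) @ \oo --> b.
  by near: om.
have c1 : forall t, 0 <= t ->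
  (fun n => n%:R^-1 * \sum_(j < n) laplace_kernel t (Xs j om)) @ \oo -->
    fine ('E_P[fun x => laplace_kernel t (X x)])%E by near: om.
have c2 : forall t, 0 <= t ->
  (fun n => n%:R^-1 * \sum_(j < n) (laplace_kernel t (Xs j om) * Xs j om `^ k0))
    @ \oo --> fine ('E_P[fun x => (laplace_kernel t (X x) * X x `^ k0)%R])%E.
  by near: om.
have c3 : forall t, 0 <= t ->
  (fun n => n%:R^-1 * \sum_(j < n) expR (- (t * Xs j om))) @ \oo -->
    fine ('E_P[fun x => expR (- (t * X x))])%E by near: om.
case: cB => b cB.
under [X in (_ <= limn_einf X)%E]eq_fun do rewrite test_statistic_div.
pose f n t := (`| n%:R^-1 *
    (\sum_(j < n) stein_term (lamhat n om) (khat n om) t (Xs j om))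
    - t / n%:R * \sum_(j < n) expR (- (t * Xs j om)) | ^+ 2 * w t)%:E.
(* The integrand of [Lambda] is the pointwise limit of the integrands [f n]. *)
have -> : Lambda X w lam0 k0 =
    (\int[lebesgue_measure]_(t in `[0%R, +oo[) limn_einf (f ^~ t))%E.
  apply: eq_integral => t; rewrite inE /= in_itv /= andbT => t0.
  have fin1 := laplace_kernel_fin_num X_pos XM t0.
  have fin2 := laplace_kernel_powR_fin_num X_pos XM k0_ge0 k0M t0.
  have fin3 := laplace_fin_num X_pos XM t0.
  rewrite (expectation_stein_term lam0_pos t0 X_pos fin1 fin2).
  have -> : ('E_P[fun om0 => (t * expR (- (t * X om0)))%R] =
      (t * fine 'E_P[fun x => expR (- (t * X x))%R])%:E)%E.
    rewrite EFinM fineK// unlock.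
    under eq_integral do rewrite EFinM.
    rewrite ge0_integralZl_EFin//.
    apply/measurable_EFinP; apply: measurableT_comp => //.
    by apply: measurable_funN; exact: measurable_funM.
  apply/esym; rewrite -EFinB -!EFinM -expr2.
  have H := statistic_cvg x0 lam0_pos k0_pos t0 kM clam ck
    (c1 t t0) (c2 t t0) (c3 t t0) cB.
  set a := (X in (X ^+ 2 * w t)%:E).
  suff : (f ^~ t) @ \oo --> (a ^+ 2 * w t)%:E by move/cvg_limn_einf_sup => [].
  apply: cvg_EFin; first exact: nearW.
  (* The sample version carries an absolute value, the population one does not. *)
  rewrite -(real_normK (num_real a)) expr2.
  exact: (cvgM (cvgM (cvg_norm H) (cvg_norm H)) (cvg_cst (w t))).
apply: (@fatou _ _ _ lebesgue_measure _ _ f).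
- exact: measurable_itv.
- by move=> n; exact: (@measurable_statistic_integrand _ w n (fun j => Xs j om)).
- move=> n t; rewrite /= in_itv /= andbT => t0.
  by rewrite lee_fin mulr_ge0 ?exprn_ge0// ltW// w_pos.
Unshelve. all: by end_near.
Qed.
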